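(* Let $F$, $K$, $t$ be as in the context. Let $a_1,a_2\in F$, $n_1,n_2\in\mathbb{Z}$ and $h\in F[X]$ be data whose depth is non-negative. Then for every Schwartz–Bruhat function $f$ on $K\times K$, with $g=f^{(a_1,a_2),(n_1,n_2)}$, the function $\Phi(x,y)=g(x,y-h(x))$ is Fubini on $F\times F$ with repeated integral $\int_K\int_Kf(u,v)\,du\,dv\,X^{n_1+n_2}$.
   Context: $F$ is a complete discrete valuation field with ring of integers $\mathcal{O}_F$, fixed uniformizer $t$, valuation $\nu$, residue map $x\mapsto\bar{x}$, and residue field $K$ a local field ($\mathbb{R}$, $\mathbb{C}$ or non-archimedean); a Haar measure on $K$ is fixed. For a complex Haar integrable $f$ on $K$, $a\in F$, $n\in\mathbb{Z}$: $f^0(x)=f(\bar{x})$ for $x\in\mathcal{O}_F$ and $0$ otherwise, and the lift $f^{a,n}$ is defined by $f^{a,n}(a+t^nx)=f^0(x)$. The integrable functions on $F$ form the $\mathbb{C}(X)$-span $\mathcal{L}(F)$ of all such lifts; $\int^F$ is the unique $\mathbb{C}(X)$-linear functional on $\mathcal{L}(F)$ with $\int^Ff^0=\int_Kf$, translation invariance, and $\int^Fg(\alpha x)dx=|\alpha|^{-1}\int^Fg$, where $|\alpha|=|\overline{\alpha t^{-\nu(\alpha)}}|_KX^{\nu(\alpha)}$; in particular $\int^Ff^{a,n}=(\int_Kf)X^n$. $\Phi:F\times F\to\mathbb{C}(X)$ is Fubini if all its horizontal and vertical sections are integrable, both resulting functions of the remaining variable are integrable, and the two repeated integrals agree. For $f$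 on $K\times K$: $f^0(x,y)=f(\bar{x},\bar{y})$ for $x,y\in\mathcal{O}_F$, else $0$; $f^{(a_1,a_2),(n_1,n_2)}(a_1+t^{n_1}x,a_2+t^{n_2}y)=f^0(x,y)$. Schwartz–Bruhat: smooth of rapid decay ($K$ archimedean) or locally constant of compact support ($K$ non-archimedean). Depth of data $a_1,a_2,n_1,n_2,h$ ($h$ non-constant): write $h(a_1+t^{n_1}X)=h(a_1)+t^{R'}q(X)$ with $R'\in\mathbb{Z}$, $q\in\mathcal{O}_F[X]$ with non-zero image in $K[X]$; the depth is $R'-n_2$. *)

(* Defs.v *)
From HB Require Import structures.
From mathcomp Require Import all_boot all_order all_algebra.
From mathcomp Require Import all_classical all_reals all_analysis.
From mathcomp Require Import complex fraction.
Set Implicit Arguments.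
Unset Strict Implicit.
Unset Printing Implicit Defensive.
Import Order.TTheory GRing.Theory Num.Theory.
Import numFieldNormedType.Exports.
Local Open Scope ring_scope.
Local Open Scope classical_set_scope.

Definition CX (R : realType) : fieldType := {fraction {poly R[i]}}.
Definition fcst {R : realType} (c : R[i]) : CX R := @FracField.tofrac _ (c%:P).
Definition Xf {R : realType} : CX R := @FracField.tofrac _ 'X.

(* (nu 0 is irrelevant: 0 is always treated separately.)              *)
Definition inO {F : fieldType} (nu : F -> int) (x : F) : Prop :=
  x = 0 \/ 0 <= nu x.

Definition vbig {F : fieldType} (nu : F -> int) (x : F) (N : int) : Prop :=
  x = 0 \/ N <= nu x.

Record is_cdvf (F K : fieldType) (nu : F -> int) (t : F) (res : F -> K) : Prop := {
  cdvf_mul : forall x y, x != 0 -> y != 0 -> nu (x * y) = nu x + nu y;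
  cdvf_add : forall x y, x != 0 -> y != 0 -> x + y != 0 ->
               Num.min (nu x) (nu y) <= nu (x + y);
  cdvf_t_neq0 : t != 0;
  cdvf_t : nu t = 1;
  cdvf_complete : forall s : nat -> F,
      (forall N : int, exists M : nat, forall m n, (M <= m)%N -> (M <= n)%N ->
         vbig nu (s m - s n) N) ->
      exists L : F, forall N : int, exists M : nat, forall n, (M <= n)%N ->
         vbig nu (s n - L) N;
  res_add : forall x y, inO nu x -> inO nu y -> res (x + y) = res x + res y;
  res_mul : forall x y, inO nu x -> inO nu y -> res (x * y) = res x * res y;
  res_one : res 1 = 1;
  res_surj : forall k : K, exists x, inO nu x /\ res x = k;
  res_ker : forall x, inO nu x -> (res x = 0 <-> vbig nu x 1)
}.

(* The local field K: a field with a nontrivial absolute value for      *)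
(* which it is locally compact (closed unit ball sequentially compact).*)
(* By the classification, these are exactly R, C (up to powers of the  *)
(* absolute value) and the non-archimedean local fields.               *)
Record is_local_field (R : realType) (K : fieldType) (av : K -> R) : Prop := {
  av_ge0 : forall x, 0 <= av x;
  av_eq0 : forall x, av x = 0 <-> x = 0;
  av_mul : forall x y, av (x * y) = av x * av y;
  av_tri : forall x y, av (x + y) <= av x + av y;
  av_nontrivial : exists x, av x != 0 /\ av x != 1;
  av_loc_compact : forall s : nat -> K, (forall n, av (s n) <= 1) ->
     exists (phi : nat -> nat) (l : K),
       (forall n, (phi n < phi n.+1)%N) /\ av l <= 1 /\
       (forall e : R, 0 < e -> exists M : nat, forall n, (M <= n)%N -> av (s (phi n) - l) < e)
}.

Definition ultrametric {R : realType} {K : fieldType} (av : K -> R) : Prop :=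
  forall x y, av (x + y) <= Num.max (av x) (av y).

(* pointed copy of K, to carry the Borel sigma-algebra *)
Definition ptd (K : fieldType) : Type := K.
HB.instance Definition _ (K : fieldType) := Choice.on (ptd K).
HB.instance Definition _ (K : fieldType) := isPointed.Build (ptd K) (0 : K).

Definition av_open {R : realType} {K : fieldType} (av : K -> R) : set (set (ptd K)) :=
  [set A | forall x : K, A x -> exists e : R, 0 < e /\
                         forall y : K, av (y - x) < e -> A y].

Notation Borel av := (g_sigma_algebraType (av_open av)).

(* Haar measure on K: translation invariant Borel measure, finite on    *)
(* compacts (equivalently on the closed unit ball), positive on nonempty*)
(* open sets.  (Regularity is automatic: K is a sigma-compact metric    *)
(* space.)                                                              *)
Definition is_Haar {R : realType} {K : fieldType} (av : K -> R)
    (mu : {measure set (Borel av) -> \bar R}) : Prop :=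
  [/\ (forall (a : K) (A : set (Borel av)), measurable A ->
          mu [set a + x | x in A] = mu A),
      (mu [set x : Borel av | (av x <= 1)%R] < +oo)%E &
      (forall A : set (Borel av), av_open av A -> A !=set0 -> (0 < mu A)%E)].

Definition Haar_integrable {R : realType} {K : fieldType} {av : K -> R}
    (mu : {measure set (Borel av) -> \bar R}) (f : K -> R[i]) : Prop :=
  mu.-integrable [set: Borel av] (fun x : Borel av => (complex.Re (f x))%:E) /\
  mu.-integrable [set: Borel av] (fun x : Borel av => (complex.Im (f x))%:E).

Definition HaarInt {R : realType} {K : fieldType} {av : K -> R}
    (mu : {measure set (Borel av) -> \bar R}) (f : K -> R[i]) : R[i] :=
  Complex (fine (\int[mu]_x (complex.Re (f x))%:E)%E)
          (fine (\int[mu]_x (complex.Im (f x))%:E)%E).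

Definition ebasis {R : realType} {m : nat} (i : 'I_m) : 'rV[R]_m := delta_mx 0 i.

Fixpoint iterD {R : realType} {m : nat} (l : seq 'I_m) (G : 'rV[R]_m -> R)
    : 'rV[R]_m -> R :=
  match l with
  | [::] => G
  | i :: l' => 'D_(ebasis i) (iterD l' G)
  end.

Definition real_schwartz {R : realType} {m : nat} (G : 'rV[R]_m -> R) : Prop :=
  (forall l : seq 'I_m, continuous (iterD l G) /\
     forall (i : 'I_m) (x : 'rV[R]_m), derivable (iterD l G) x (ebasis i)) /\
  (forall (l : seq 'I_m) (N : nat), exists c : R, forall x : 'rV[R]_m,
     (1 + `|x|) ^+ N * `|iterD l G x| <= c).

Definition schwartz {R : realType} {m : nat} (G : 'rV[R]_m -> R[i]) : Prop :=
  real_schwartz (fun x => complex.Re (G x)) /\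
  real_schwartz (fun x => complex.Im (G x)).

(* phi : K -> S is a field isomorphism which is a homeomorphism:        *)
(* av = |phi _|^c for some c > 0                                        *)
Definition top_field_iso {R : realType} {K S : fieldType} (av : K -> R)
    (absS : S -> R) (phi : K -> S) (psi : S -> K) : Prop :=
  [/\ cancel phi psi, cancel psi phi,
      (forall x y, phi (x + y) = phi x + phi y),
      (forall x y, phi (x * y) = phi x * phi y) & phi 1 = 1] /\
      (exists c : R, 0 < c /\ forall x, av x = powR (absS (phi x)) c).

Definition Schwartz_Bruhat {R : realType} {K : fieldType} (av : K -> R)
    (f : K * K -> R[i]) : Prop :=
  (ultrametric av /\
     (forall p : K * K, exists e : R, 0 < e /\ forall q : K * K,
        av (q.1 - p.1) < e -> av (q.2 - p.2) < e -> f q = f p) /\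
     (exists r : R, forall p : K * K, f p != 0 -> av p.1 <= r /\ av p.2 <= r))
  \/
  (exists (phi : K -> R) (psi : R -> K),
     top_field_iso av (fun x : R => `|x|) phi psi /\
     schwartz (fun v : 'rV[R]_2 => f (psi (v 0 0), psi (v 0 1))))
  \/
  (exists (phi : K -> R[i]) (psi : R[i] -> K),
     top_field_iso av (fun z : R[i] => Normc.normc z) phi psi /\
     schwartz (fun v : 'rV[R]_4 =>
        f (psi (Complex (v 0 0) (v 0 1)), psi (Complex (v 0 2) (v 0 3))))).

Definition lift0 {R : realType} {F K : fieldType} (nu : F -> int) (res : F -> K)
    (f : K -> R[i]) (x : F) : CX R :=
  if `[< inO nu x >] then fcst (f (res x)) else 0.

(* f^{a,n} : f^{a,n}(a + t^n x) = f^0(x) *)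
Definition liftF {R : realType} {F K : fieldType} (nu : F -> int) (t : F)
    (res : F -> K) (f : K -> R[i]) (a : F) (n : int) (y : F) : CX R :=
  lift0 nu res f ((y - a) / t ^ n).

Definition lift2F {R : realType} {F K : fieldType} (nu : F -> int) (t : F)
    (res : F -> K) (f : K * K -> R[i]) (a1 a2 : F) (n1 n2 : int) (x y : F)
    : CX R :=
  let x' := (x - a1) / t ^ n1 in
  let y' := (y - a2) / t ^ n2 in
  if `[< inO nu x' /\ inO nu y' >] then fcst (f (res x', res y')) else 0.

(* (Well defined by the existence/uniqueness of int^F.)                  *)
Definition F_integral {R : realType} {F K : fieldType} (nu : F -> int) (t : F)
    (res : F -> K) (av : K -> R) (mu : {measure set (Borel av) -> \bar R})
    (g : F -> CX R) (c : CX R) : Prop :=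
  exists s : seq (CX R * ((K -> R[i]) * (F * int))),
    (forall e, e \in s -> Haar_integrable mu e.2.1) /\
    (forall y, g y = \sum_(e <- s) e.1 * liftF nu t res e.2.1 e.2.2.1 e.2.2.2 y) /\
    c = \sum_(e <- s) e.1 * fcst (HaarInt mu e.2.1) * Xf ^ e.2.2.2.

Definition is_Fubini {R : realType} {F K : fieldType} (nu : F -> int) (t : F)
    (res : F -> K) (av : K -> R) (mu : {measure set (Borel av) -> \bar R})
    (Phi : F -> F -> CX R) (c : CX R) : Prop :=
  exists A B : F -> CX R,
    (forall x, F_integral nu t res mu (fun y => Phi x y) (A x)) /\
    (forall y, F_integral nu t res mu (fun x => Phi x y) (B y)) /\
    F_integral nu t res mu A c /\ F_integral nu t res mu B c.

(* depth of (a1, a2, n1, n2, h) is non-negative (h non-constant):       *)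
(* h(a1 + t^n1 X) = h(a1) + t^R' q(X), q in O_F[X] with non-zero        *)
(* reduction in K[X], and R' - n2 >= 0.  (a2 plays no role.)            *)
Definition depth_nonneg {F K : fieldType} (nu : F -> int) (t : F) (res : F -> K)
    (a1 : F) (n1 n2 : int) (h : {poly F}) : Prop :=
  (1 < size h)%N /\
  exists (R' : int) (q : {poly F}),
    h \Po (a1%:P + t ^ n1 *: 'X) = (h.[a1])%:P + t ^ R' *: q /\
    (forall i, inO nu q`_i) /\ (exists i, res q`_i != 0) /\
    0 <= R' - n2.

(* Main.v *)
(* On the residue field, Phi is the shear f(u, w - P u), where P is the reduction
   of a polynomial with integral coefficients (this is where non-negative depth
   is used).  So every section of Phi, and each of its two partial integrals, is
   the lift of a function on K, and the statement reduces to Fubini on K for the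
   sheared function together with translation invariance of the Haar measure.
   Absolute integrability is uniform in K: real and imaginary parts of f are
   continuous and bounded by C_N (1+|u|)^-N (1+|v|)^-N for all N, while covering
   a ball by translates of smaller ones shows that its Haar measure grows
   polynomially in the radius. *)
Require Import Defs.
From HB Require Import structures.
From mathcomp Require Import all_boot all_order all_algebra.
From mathcomp Require Import all_classical all_reals all_analysis.
From mathcomp Require Import complex fraction.
From mathcomp Require Import measurable_realfun.
From mathcomp Require Import ring zify.
Import Order.TTheory GRing.Theory Num.Theory.
Import numFieldNormedType.Exports.
Local Open Scope ring_scope.
Local Open Scope classical_set_scope.

Set Implicit Arguments.
Unset Strict Implicit.

(** * Local fields *)

Lemma av0 (R : realType) (K : fieldType) (av : K -> R) :
  is_local_field av -> av 0 = 0.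
Proof. by move=> HK; apply/(av_eq0 HK). Qed.

Lemma av_neq0 (R : realType) (K : fieldType) (av : K -> R) (x : K) :
  is_local_field av -> x != 0 -> 0 < av x.
Proof.
move=> HK x0; rewrite lt_neqAle (av_ge0 HK) andbT eq_sym.
by apply: contra x0 => /eqP /(av_eq0 HK) ->.
Qed.

Lemma av1 (R : realType) (K : fieldType) (av : K -> R) :
  is_local_field av -> av 1 = 1.
Proof.
move=> HK; have h0 := av_neq0 HK (oner_neq0 K).
by apply: (mulfI (lt0r_neq0 h0)); rewrite -(av_mul HK) !mulr1.
Qed.

Lemma avN (R : realType) (K : fieldType) (av : K -> R) (x : K) :
  is_local_field av -> av (- x) = av x.
Proof.
move=> HK; suff h : av (-1) = 1 by rewrite -mulN1r (av_mul HK) h mul1r.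
have : av (-1) ^+ 2 = 1 by rewrite expr2 -(av_mul HK) mulrNN mulr1 (av1 HK).
move/eqP; rewrite sqrf_eq1 => /orP[/eqP//|/eqP e].
by have := av_ge0 HK (-1); rewrite e lerNr oppr0 ler10.
Qed.

Lemma avB (R : realType) (K : fieldType) (av : K -> R) (x y : K) :
  is_local_field av -> av (x - y) = av (y - x).
Proof. by move=> HK; rewrite -opprB (avN _ HK). Qed.

Lemma avX (R : realType) (K : fieldType) (av : K -> R) (x : K) (n : nat) :
  is_local_field av -> av (x ^+ n) = av x ^+ n.
Proof.
move=> HK; elim: n => [|n IH]; first by rewrite !expr0 (av1 HK).
by rewrite !exprS (av_mul HK) IH.
Qed.

Lemma avV (R : realType) (K : fieldType) (av : K -> R) (x : K) :
  is_local_field av -> x != 0 -> av x^-1 = (av x)^-1.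
Proof.
move=> HK x0; have h := lt0r_neq0 (av_neq0 HK x0).
by apply: (mulfI h); rewrite -(av_mul HK) !divff // (av1 HK).
Qed.

Lemma av_tri_sub (R : realType) (K : fieldType) (av : K -> R) (x y z : K) :
  is_local_field av -> av (x - z) <= av (x - y) + av (y - z).
Proof. by move=> HK; rewrite -(subrKA y); exact: av_tri HK _ _. Qed.

Lemma av_gt1 (R : realType) (K : fieldType) (av : K -> R) :
  is_local_field av -> exists z, 1 < av z.
Proof.
move=> HK; have [x [x0 x1]] := av_nontrivial HK.
have xn0 : x != 0 by apply: contra x0 => /eqP ->; rewrite (av0 HK).
have [h|h|h] := ltrgtP (av x) 1; last by rewrite h eqxx in x1.
  by exists x^-1; rewrite (avV HK) // invf_gt1 // (av_neq0 HK).
by exists x.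
Qed.

(** Bernoulli's inequality [1 + k (z - 1) <= z ^ k], with [k] chosen so that [k (z - 1)] already
    exceeds [r]. *)
Lemma expr_unbounded (R : realType) (r z : R) : 1 < z -> exists n, r <= z ^+ n.
Proof.
move=> z1; have zi : 0 < z - 1 by rewrite subr_gt0.
pose k := (Num.truncn (r / (z - 1))).+1; exists k.
have h : r <= k%:R * (z - 1).
  by rewrite -ler_pdivrMr //; apply/ltW; rewrite truncnS_gt // num_real.
apply: le_trans h _; rewrite mulr_natl.
have bernoulli : 1 + (z - 1) *+ k <= z ^+ k.
  elim: k => [|k IH]; first by rewrite mulr0n expr0 addr0.
  rewrite exprS -[X in _ <= X * _](subrK 1 z) mulrDl mul1r mulrS.
  rewrite addrCA lerD //.
  by rewrite ler_peMr ?(ltW zi) // exprn_ege1 // ltW.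
by apply: le_trans bernoulli; rewrite lerDr.
Qed.

(** If the unit ball had no finite [e0]-net, a greedy choice would give a sequence with terms
    pairwise [e0] apart, which has no convergent subsequence. Multiplication by a power of an
    element with [av z > 1] carries nets of the unit ball to balls of any radius. *)
Lemma closed_ball_totally_bounded (R : realType) (K : fieldType) (av : K -> R)
    (r e : R) : is_local_field av -> 0 < e ->
  exists s : seq K, forall x, av x <= r -> exists2 y, y \in s & av (x - y) < e.
Proof.
move=> HK; have unit_ball e0 : 0 < e0 ->
    exists s : seq K, forall x, av x <= 1 -> exists2 y, y \in s & av (x - y) < e0.
  move=> e00; apply: contrapT => /forallNP hno.
  have /choice[g hg] : forall s : seq K,
      exists x, av x <= 1 /\ forall y, y \in s -> e0 <= av (x - y).
    move=> s; have /existsNP[x /not_implyP[x1 hx]] := hno s.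
    exists x; split => // y ys; rewrite leNgt; apply/negP => hy.
    by apply: hx; exists y.
  (* [L n] lists the first [n] points chosen; [sq n] is the next one, at distance at least [e0] from
     all of them. *)
  pose L := fix L n := if n is n'.+1 then g (L n') :: L n' else [::].
  pose sq n := g (L n).
  have inL m n : (m < n)%N -> sq m \in L n.
    elim: n => // n IH; rewrite ltnS leq_eqVlt => /orP[/eqP->|/IH h] /=.
      exact: mem_head.
    by rewrite in_cons h orbT.
  have [phi [l [phiS [_ hl]]]] := av_loc_compact HK (fun n => (hg (L n)).1).
  have e02 : 0 < e0 / 2 by rewrite divr_gt0.
  have [M hM] := hl _ e02.
  (* Two consecutive terms of the subsequence lie within [e0 / 2] of the limit, hence less than [e0]
     apart. *)
  have h1 := hM M (leqnn _); have h2 := hM M.+1 (leqnSn _).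
  have := (hg (L (phi M.+1))).2 _ (inL _ _ (phiS M)); rewrite leNgt => /negP; apply.
  apply: le_lt_trans (av_tri_sub _ l _ HK) _.
  rewrite [ltRHS](splitr e0); apply: ltrD => //.
  by rewrite (avB _ _ HK).
move=> e0; have [z z1] := av_gt1 HK.
have z0 : z != 0 by apply/eqP => z0; move: z1; rewrite z0 (av0 HK) ltr10.
have [n hn] := expr_unbounded r z1.
have zn0 : z ^+ n != 0 by rewrite expf_neq0.
have zn_gt0 := av_neq0 HK zn0.
(* Multiplication by [z ^ n] stretches distances by [av (z ^ n)], so the net of the unit ball is
   taken finer by that factor. *)
have [s hs] := unit_ball (e / av (z ^+ n)) (divr_gt0 e0 zn_gt0).
exists [seq z ^+ n * y | y <- s] => x xr.
have [|y ys hy] := hs (x / z ^+ n).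
  rewrite (av_mul HK) (avV HK) // ler_pdivrMr // mul1r (avX _ _ HK).
  exact: le_trans hn.
exists (z ^+ n * y); first by apply: map_f.
move: hy; rewrite ltr_pdivlMr // -(av_mul HK) mulrBl divfK //.
by rewrite [y * _]mulrC.
Qed.

(** The dense sequence runs through finite [1/(n+1)]-nets of the balls of radius [n], for all
    [n]. *)
Lemma av_separable (R : realType) (K : fieldType) (av : K -> R) :
  is_local_field av ->
  exists d : nat -> K, forall x (e : R), 0 < e -> exists i, av (x - d i) < e.
Proof.
move=> HK; have /choice[s hs] n := @closed_ball_totally_bounded R K av n%:R
  (n.+1%:R^-1) HK (ltac:(by rewrite invr_gt0)).
(* [i] codes a pair (net, position in the net); the default 0 fills indices that code nothing. *)
exists (fun i => if @unpickle (nat * nat)%type i is Some (n, j) then nth 0 (s n) j else 0).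
move=> x e e0.
pose n := maxn (Num.truncn (av x)).+1 (Num.truncn e^-1).+1.
have h1 : av x <= n%:R.
  apply: (@le_trans _ _ (Num.truncn (av x)).+1%:R).
    by apply/ltW; rewrite truncnS_gt // num_real.
  by rewrite ler_nat leq_maxl.
have h2 : n.+1%:R^-1 < e.
  rewrite invf_plt ?posrE //; apply: (@lt_le_trans _ _ (Num.truncn e^-1).+1%:R).
    by rewrite truncnS_gt // num_real.
  by rewrite ler_nat (leq_trans (leq_maxr _ _) (leqnSn _)).
have [y ys hy] := hs n x h1.
exists (pickle (n, index y (s n))); rewrite pickleK nth_index //.
exact: lt_trans h2.
Qed.

(** * Haar measure *)

Lemma av_open_measurable (R : realType) (K : fieldType) (av : K -> R)
    (A : set (Borel av)) : av_open av A -> measurable A.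
Proof. by move=> oA; apply: sub_sigma_algebra. Qed.

Lemma av_open_ball (R : realType) (K : fieldType) (av : K -> R) (c : K) (e : R) :
  is_local_field av -> av_open av [set y | av (y - c) < e].
Proof.
move=> HK x /= xe; exists (e - av (x - c)); rewrite subr_gt0; split => // y hy.
by apply: le_lt_trans (av_tri_sub _ x _ HK) _; rewrite -ltrBrDr.
Qed.

Lemma measurable_av (R : realType) (K : fieldType) (av : K -> R) :
  is_local_field av -> measurable_fun setT (av : Borel av -> R).
Proof.
move=> HK; apply: (measurability _ (RGenInftyO.measurableE R)) => //.
move=> _ [_ [a ->] <-]; rewrite setTI; apply: av_open_measurable.
have -> : av @^-1` `]-oo, a[ = [set y | av (y - 0) < a].
  by apply/seteqP; split => x; rewrite /= in_itv /= subr0.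
exact: av_open_ball.
Qed.

Lemma measurable_av_closed_ball (R : realType) (K : fieldType) (av : K -> R)
    (r : R) : is_local_field av -> measurable [set x : Borel av | av x <= r].
Proof.
move=> HK; have := measurable_av HK measurableT (measurable_itv (Interval -oo%O (BRight r))).
by rewrite setTI.
Qed.

(* Separability is what puts the open sets of K * K in the product of the Borel
   sigma-algebras. *)
Lemma open_prod_measurable (R : realType) (K : fieldType) (av : K -> R)
    (A : set (Borel av * Borel av)) : is_local_field av ->
  (forall p : K * K, A p -> exists e : R, 0 < e /\ forall q : K * K,
      av (q.1 - p.1) < e -> av (q.2 - p.2) < e -> A q) ->
  measurable A.
Proof.
move=> HK oA; have [d hd] := av_separable HK.
(* Countably many boxes: centres in the dense sequence, radii [1/(k+1)]. *)
pose box (i : nat * nat * nat) : set (Borel av * Borel av) :=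
  [set y : Borel av | av ((y : K) - d i.1.1) < i.2.+1%:R^-1] `*`
  [set y : Borel av | av ((y : K) - d i.1.2) < i.2.+1%:R^-1].
have mbox i : measurable (box i).
  by apply: measurableX; apply: av_open_measurable; apply: av_open_ball.
have -> : A = \bigcup_i (if `[< box i `<=` A >] then box i else set0).
  apply/seteqP; split; last by move=> p [i _]; case: asboolP => // h /h.
  move=> [x y] Axy; have [e [e0 he]] := oA _ Axy.
  (* With radius below [e / 2], a box containing [(x, y)] stays within [e] of it in both
     coordinates, hence inside [A]. *)
  pose k := Num.truncn (2 / e).
  have ke : k.+1%:R^-1 < e / 2.
    rewrite -[X in _ < X]invf_div ltf_pV2 ?posrE ?divr_gt0 //.
    by rewrite truncnS_gt // num_real.
  have k0 : 0 < k.+1%:R^-1 :> R by rewrite invr_gt0.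
  have [i hi] := hd x _ k0; have [j hj] := hd y _ k0.
  exists (i, j, k) => //; case: asboolP => [_|[]] //.
  move=> [x' y'] [/= hx hy]; apply: he => /=.
    apply: le_lt_trans (av_tri_sub _ (d i) _ HK) _; rewrite (avB (d i) _ HK).
    by apply: lt_trans (ltrD hx hi) _; rewrite [ltRHS]splitr ltrD.
  apply: le_lt_trans (av_tri_sub _ (d j) _ HK) _; rewrite (avB (d j) _ HK).
  by apply: lt_trans (ltrD hy hj) _; rewrite [ltRHS]splitr ltrD.
apply: countable_bigcupT_measurable; first exact: countableP.
by move=> i; case: ifP.
Qed.

Definition continuous2 (R : realType) (K : fieldType) (av : K -> R)
    (G : K * K -> R) : Prop :=
  forall (p : K * K) (e : R), 0 < e -> exists d : R, 0 < d /\ forall q : K * K,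
    av (q.1 - p.1) < d -> av (q.2 - p.2) < d -> `|G q - G p| < e.

Lemma continuous2_measurable (R : realType) (K : fieldType) (av : K -> R)
    (G : K * K -> R) : is_local_field av -> continuous2 av G ->
  measurable_fun setT (G : Borel av * Borel av -> R).
Proof.
move=> HK cG; apply: (measurability _ (RGenInftyO.measurableE R)) => //.
move=> _ [_ [a ->] <-]; rewrite setTI; apply: open_prod_measurable => // p.
rewrite /= in_itv /= => Gpa.
have [|d [d0 hd]] := cG p (a - G p); first by rewrite subr_gt0.
exists d; split => // q h1 h2; rewrite in_itv /=.
have := hd q h1 h2; rewrite ltr_norml => /andP[_].
by rewrite ltrD2r.
Qed.

Lemma measurable_translate (R : realType) (K : fieldType) (av : K -> R) (a : K) :
  measurable_fun setT (fun x : Borel av => ((x : K) - a : Borel av)).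
Proof.
apply: (measurability _ (erefl : @measurable _ (Borel av) = <<s av_open av >>)) => //.
move=> _ [U oU <-]; rewrite setTI; apply: av_open_measurable => x /= /oU[e [e0 he]].
by exists e; split => // y hy; apply: he; rewrite opprB addrA subrK.
Qed.

(** Induction on the list of centres: the translate [c + B] has the measure of [B], and what it
    leaves of [A] is covered by the translates of [B] by the other centres. *)
Lemma Haar_cover (R : realType) (K : fieldType) (av : K -> R)
    (mu : {measure set (Borel av) -> \bar R}) (s : seq K) (A B : set (Borel av)) :
  is_Haar mu -> measurable A -> measurable B ->
  (forall x : K, A x -> exists2 y, y \in s & B (x - y)) ->
  (mu A <= (size s)%:R%:E * mu B)%E.
Proof.
move=> [muT _ _] mA mB; elim: s A mA => [|c s IH] A mA hA.
  by rewrite mul0e (_ : A = set0) ?measure0 // -subset0 => x /hA[].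
pose C : set (Borel av) := [set (c + x : K) | x in B].
have mC : measurable C.
  rewrite (_ : C = (fun x : Borel av => (x : K) - c : Borel av) @^-1` B).
    by rewrite -[X in measurable X]setTI; exact: (@measurable_translate R K av c).
  apply/seteqP; split => x /=; first by move=> [y By <-]; rewrite addrAC subrr add0r.
  by move=> Bx; exists (x - c) => //; rewrite addrC subrK.
have mD : measurable (A `\` C) by exact: measurableD.
have hD : forall x : K, (A `\` C) x -> exists2 y, y \in s & B (x - y).
  move=> x [/hA[y + By] nx]; rewrite in_cons => /orP[/eqP yc|ys]; last by exists y.
  by exfalso; apply: nx; exists (x - c); rewrite -?yc // addrC subrK.
have := IH _ mD hD => {}IH.
apply: (@le_trans _ _ (mu (C `|` (A `\` C)))).
  apply: le_measure; rewrite ?inE //; first exact: measurableU.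
  by move=> x Ax; have [Cx|nCx] := pselect (C x); [left|right].
apply: le_trans (measureU2 _ mC mD) _.
rewrite /= -natr1 addrC EFinD ge0_muleDl ?lee_fin // muT //.
by rewrite mul1e; apply: leeD.
Qed.

(** A finite 1-net of the ball of radius [av z], scaled by [z ^ n], covers the ball of radius
    [av z ^ n.+1] by a fixed number of translates of the ball of radius [av z ^ n]. The measure thus
    grows at most by that factor at each step. *)
Lemma Haar_growth (R : realType) (K : fieldType) (av : K -> R)
    (mu : {measure set (Borel av) -> \bar R}) : is_local_field av -> is_Haar mu ->
  exists (z : R) (M : nat), [/\ 1 < z, (0 < M)%N & forall n,
    (mu [set x : Borel av | (av x <= z ^+ n)%R] <=
     (M ^ n)%:R%:E * mu [set x : Borel av | (av x <= 1)%R])%E].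
Proof.
move=> HK Hmu; have [z z1] := av_gt1 HK.
have z0 : z != 0 by apply/eqP => z0; move: z1; rewrite z0 (av0 HK) ltr10.
have [s hs] := closed_ball_totally_bounded (av z) HK ltr01.
(* The successor makes [M] positive, so that powers of [2 M] can be divided by later. *)
exists (av z), (size s).+1; split => // n.
elim: n => [|n IH]; first by rewrite expn0 mul1e expr0.
have step : (mu [set x : Borel av | (av x <= av z ^+ n.+1)%R] <=
    (size s)%:R%:E * mu [set x : Borel av | (av x <= av z ^+ n)%R])%E.
  rewrite -(size_map (fun y => z ^+ n * y) s).
  apply: Haar_cover => //; try exact: measurable_av_closed_ball.
  move=> x /= hx; have zn0 : z ^+ n != 0 by rewrite expf_neq0.
  have zn_gt0 := av_neq0 HK zn0.
  have [|y ys hy] := hs (x / z ^+ n).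
    by rewrite (av_mul HK) (avV HK) // ler_pdivrMr // (avX _ _ HK) -exprS.
  exists (z ^+ n * y); first exact: map_f.
  rewrite -{1}(divfK zn0 x) [z ^+ n * y]mulrC -mulrBl (av_mul HK) (avX _ _ HK).
  by apply: ler_piMl; [apply/exprn_ge0/(av_ge0 HK)|exact: ltW].
apply: le_trans step _; rewrite expnS natrM EFinM -muleA.
apply: lee_pmul => //.
by rewrite lee_fin ler_nat.
Qed.

Lemma Haar_sigma_finite (R : realType) (K : fieldType) (av : K -> R)
    (mu : {measure set (Borel av) -> \bar R}) : is_local_field av -> is_Haar mu ->
  sigma_finite setT mu.
Proof.
move=> HK Hmu; have [z [M [z1 _ hM]]] := Haar_growth HK Hmu.
exists (fun n => [set x : Borel av | (av x <= z ^+ n)%R]) => [|n].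
  apply/esym; rewrite -subTset => x _.
  by have [n hn] := expr_unbounded (av x) z1; exists n.
split; first exact: measurable_av_closed_ball.
apply: le_lt_trans (hM n) _; have [_ b_fin _] := Hmu.
by rewrite lte_mul_pinfty // lee_fin.
Qed.

(* Balls of radius z ^ n have measure O(M ^ n), so the integral converges as soon
   as z ^ N >= 2 M: the function is dominated by the sum of 2 M (2 M)^-n 1_{B n}. *)
Lemma decay_integrable (R : realType) (K : fieldType) (av : K -> R)
    (mu : {measure set (Borel av) -> \bar R}) : is_local_field av -> is_Haar mu ->
  exists N, mu.-integrable setT (fun x : Borel av => (((1 + av x) ^+ N)^-1)%:E).
Proof.
move=> HK Hmu; have [z [M [z1 M0 hM]]] := Haar_growth HK Hmu.
pose q : R := 2 * M%:R.
have q0 : 0 < q by rewrite mulr_gt0 // ltr0n.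
have [N hN] := expr_unbounded q z1; exists N.
pose B n := [set x : Borel av | (av x <= z ^+ n)%R].
have mB n : measurable (B n) by exact: measurable_av_closed_ball.
pose c n : R := q / q ^+ n.
have c0 n : 0 <= c n by rewrite divr_ge0 // ?exprn_ge0 // ltW.
have av1_gt0 x : 0 < 1 + av x by rewrite ltr_pwDl // (av_ge0 HK).
have mpsi : measurable_fun setT (fun x : Borel av => ((1 + av x) ^+ N)^-1).
  rewrite (_ : (fun x => _) = (fun x : Borel av => ((1 + av x) ^+ N) `^ (-1))).
    apply: (measurableT_comp (measurable_powR (-1))).
    by apply: measurable_funX; apply: measurable_funD => //; exact: measurable_av.
  by apply/funext => x; rewrite powR_inv1 // exprn_ge0 // ltW.
apply/integrableP; split; first exact/measurable_EFinP.
have [_ b_fin _] := Hmu; set b := mu _ in b_fin.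
have b0 : (0 <= b)%E by exact: measure_ge0.
have bE : b = (fine b)%:E by apply/esym/fineK; rewrite ge0_fin_numE.
have fb0 : 0 <= fine b by rewrite fine_ge0.
pose S x := (\sum_(n <oo) (c n * \1_(B n) x)%:E)%E.
have t0 n x : (0 <= (c n * \1_(B n) x)%:E)%E by rewrite lee_fin mulr_ge0.
have mt n : measurable_fun setT (fun x => (c n * \1_(B n) x)%:E).
  by apply/measurable_EFinP; apply: measurable_funM => //; exact: measurable_indic.
apply: (@le_lt_trans _ _ (\int[mu]_x S x)%E).
  apply: ge0_le_integral => //.
  - by apply: measurableT_comp => //; exact/measurable_EFinP.
  - rewrite /S; under eq_fun do rewrite eseries_cond; exact: ge0_emeasurable_sum.
  - move=> x _; rewrite gee0_abs ?lee_fin ?invr_ge0 ?exprn_ge0 ?(ltW (av1_gt0 _)) //.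
    have exn : exists n, av x <= z ^+ n by exact: expr_unbounded.
    (* By minimality [z ^ (n-1) <= av x] when [n > 0], so [(1 + av x) ^ N >= (z ^ N) ^ (n-1) >= q ^
       (n-1)], the inverse of [c n]. When [n = 0], the bound is [c 0 = q >= 1]. *)
    pose n := ex_minn exn.
    have hle : (((1 + av x) ^+ N)^-1 <= c n * \1_(B n) x).
      rewrite /n; case: ex_minnP => m hm hmin.
      rewrite indicE mem_set // mulr1 /c.
      case: m hm hmin => [|m] hm hmin.
        rewrite expr0 divr1; apply: (@le_trans _ _ 1).
          by rewrite invf_le1 ?exprn_gt0 // exprn_ege1 // lerDl (av_ge0 HK).
        by rewrite /q -natrM ler1n muln_gt0.
      rewrite exprS invfM mulVKf ?gt_eqF // lef_pV2 ?posrE ?exprn_gt0 //.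
      apply: (@le_trans _ _ ((z ^+ N) ^+ m)).
        by apply: lerXn2r; rewrite ?nnegrE ?exprn_ge0 // ltW // (lt_trans _ z1).
      rewrite exprAC; apply: lerXn2r; rewrite ?nnegrE ?exprn_ge0 ?(ltW (av1_gt0 _)) //.
        by rewrite ltW // (lt_trans _ z1).
      have : z ^+ m <= av x.
        by rewrite leNgt; apply/negP => /ltW /hmin; rewrite ltnn.
      by move=> h; rewrite (le_trans h) // lerDr.
    apply: (@le_trans _ _ (\sum_(0 <= i < n.+1) (c i * \1_(B i) x)%:E)%E).
      rewrite big_nat_recr //=; apply: (@le_trans _ _ (c n * \1_(B n) x)%:E).
        by rewrite lee_fin.
      by rewrite leeDr // sume_ge0.
    by apply: nneseries_lim_ge.
rewrite integral_nneseries //.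
(* The n-th term is at most [c n * M ^ n * b = 2 M b / 2 ^ n], written as [4 M b / 2 ^ n.+1] to
   match the standard geometric series with sum [4 M b]. *)
apply: (@le_lt_trans _ _ (\sum_(n <oo) ((4 * M%:R * fine b) / (2 ^ n.+1)%:R)%:E)%E).
  apply: lee_nneseries => [n _ _|n _]; first by apply: integral_ge0 => x _; exact: t0.
  under eq_integral do rewrite EFinM.
  rewrite ge0_integralZl_EFin //; last exact/measurable_EFinP/measurable_indic.
  rewrite integral_indic // setIT.
  apply: (@le_trans _ _ ((c n)%:E * ((M ^ n)%:R%:E * b))%E).
    by apply: lee_pmul; rewrite ?lee_fin //; exact: hM.
  rewrite bE -!EFinM lee_fin le_eqVlt; apply/orP; left; apply/eqP.
  rewrite /c /q exprMn natrX natrX exprS; field.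
  by rewrite !expf_neq0 // pnatr_eq0 -lt0n.
apply: le_lt_trans (epsilon_trick0 _ _) _; last exact: ltry.
by rewrite !mulr_ge0.
Qed.

(** The pushforward of [mu] under [x - a] is [mu] itself, since the preimage of [A] is the translate
    [a + A]. *)
Lemma ge0_Haar_translate (R : realType) (K : fieldType) (av : K -> R)
    (mu : {measure set (Borel av) -> \bar R}) (a : K) (g : Borel av -> \bar R) :
  is_Haar mu -> measurable_fun setT g -> (forall x, (0 <= g x)%E) ->
  (\int[mu]_x g ((x : K) - a)%R = \int[mu]_x g x)%E.
Proof.
move=> [muT _ _] mg g0.
have mphi := @measurable_translate R K av a.
rewrite -[LHS](ge0_integral_pushforward mphi mu (D := setT)) //.
apply: eq_measure_integral => A mA _; rewrite /= /pushforward -[RHS](muT a) //.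
congr (mu _); apply/seteqP; split => x /=; last first.
  by move=> [y Ay <-]; rewrite addrAC subrr add0r.
by move=> Ax; exists (x - a) => //; rewrite addrC subrK.
Qed.

Lemma Haar_translate (R : realType) (K : fieldType) (av : K -> R)
    (mu : {measure set (Borel av) -> \bar R}) (a : K) (g : Borel av -> \bar R) :
  is_Haar mu -> measurable_fun setT g ->
  (\int[mu]_x g ((x : K) - a)%R = \int[mu]_x g x)%E.
Proof.
move=> Hmu mg; rewrite integralE [RHS]integralE; congr (_ - _)%E.
  rewrite -(ge0_Haar_translate a Hmu (g := g^\+%E)) //; first by apply: eq_integral => x _; rewrite !funeposE.
  exact: measurable_funepos.
rewrite -(ge0_Haar_translate a Hmu (g := g^\-%E)) //; first by apply: eq_integral => x _; rewrite !funenegE.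
exact: measurable_funeneg.
Qed.

(** * Fubini for sheared functions of rapid decay *)

(** The weight is a product, so that the resulting bound on [G] separates the two variables. *)
Definition rapid_decay (R : realType) (K : fieldType) (av : K -> R)
    (G : K * K -> R) : Prop :=
  forall N : nat, exists C : R, forall p : K * K,
    `|G p| * ((1 + av p.1) ^+ N * (1 + av p.2) ^+ N) <= C.

Definition av_continuous (R : realType) (K : fieldType) (av : K -> R)
    (P : K -> K) : Prop :=
  forall (x : K) (e : R), 0 < e -> exists d : R, 0 < d /\
    forall y : K, av (y - x) < d -> av (P y - P x) < e.

Lemma continuous2_shear (R : realType) (K : fieldType) (av : K -> R)
    (G : K * K -> R) (P : K -> K) : is_local_field av ->
  continuous2 av G -> av_continuous av P ->
  continuous2 av (fun q => G (q.1, q.2 - P q.1)).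
Proof.
move=> HK cG cP p e e0; have [d [d0 hd]] := cG (p.1, p.2 - P p.1) e e0.
have d2 : 0 < d / 2 by rewrite divr_gt0.
have [d' [d'0 hd']] := cP p.1 _ d2.
exists (Num.min (d / 2) d'); split; first by rewrite lt_min d2.
move=> q; rewrite !lt_min => /andP[q1 /hd' qP] /andP[q2 _].
apply: hd => /=; first by apply: lt_trans q1 _; rewrite ltr_pdivrMr // ltr_pMr // ltr1n.
have -> : q.2 - P q.1 - (p.2 - P p.1) = (q.2 - p.2) - (P q.1 - P p.1) by ring.
apply: le_lt_trans (av_tri HK _ _) _; rewrite (avN _ HK).
by rewrite [ltRHS]splitr ltrD.
Qed.

(** For fixed [u] the shear is a translation in the second variable, so invariance of [mu] removes
    it from the inner integral. The double integral of the absolute value is then bounded by [C]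
    times the square of the integral of [phi], and Fubini applies to the sheared function. *)
Lemma shear_Fubini (R : realType) (K : fieldType) (av : K -> R)
    (mu : {measure set (Borel av) -> \bar R}) (G : K * K -> R) (P : K -> K) :
  is_local_field av -> is_Haar mu -> continuous2 av G -> rapid_decay av G ->
  av_continuous av P ->
  [/\ forall u : K, mu.-integrable setT (fun v : Borel av => (G (u, v))%:E),
      mu.-integrable setT (fun u : Borel av =>
        (fine (\int[mu]_v (G (u, v))%:E)%E)%:E),
      forall w : K, mu.-integrable setT (fun u : Borel av =>
        (G (u : K, w - P u))%:E),
      mu.-integrable setT (fun w : Borel av =>
        (fine (\int[mu]_u (G (u : K, ((w : K) - P u)%R))%:E)%E)%:E) &
      (\int[mu]_w (fine (\int[mu]_u (G (u : K, ((w : K) - P u)%R))%:E)%E)%:E =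
       \int[mu]_u (fine (\int[mu]_v (G (u, v))%:E)%E)%:E)%E].
Proof.
move=> HK Hmu cG dG cP.
have sf := Haar_sigma_finite HK Hmu.
(* [m] is [mu] itself, equipped with sigma-finiteness so that the product measure and Fubini's
   theorem are available. *)
pose sf1 := @isSFinite.Build _ _ _ (Measure.sort mu) (sfinite_measure_sigma_finite sf).
pose sf2 := @isSigmaFinite.Build _ _ _ (Measure.sort mu) sf.
pose m := HB.pack_for {sigma_finite_measure set (Borel av) -> \bar R}
  (Measure.sort mu) (Measure.class mu) sf1 sf2.
have [N iphi] := decay_integrable HK Hmu.
pose phi (x : K) : R := ((1 + av x) ^+ N)^-1.
have [C hC] := dG N.
have pos x : 0 < (1 + av x) ^+ N by rewrite exprn_gt0 // ltr_pwDl // (av_ge0 HK).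
have phi0 x : 0 <= phi x by rewrite invr_ge0 ltW.
have phi1 x : phi x <= 1.
  by rewrite invf_le1 // exprn_ege1 // lerDl (av_ge0 HK).
have C0 : 0 <= C.
  by apply: le_trans (hC (0, 0)); rewrite !mulr_ge0 // ltW.
have Gle u v : `|G (u, v)| <= C * phi u * phi v.
  have := hC (u, v); rewrite /= mulrA -ler_pdivlMr // -ler_pdivlMr //.
  by rewrite mulrAC.
pose H (q : K * K) := G (q.1, q.2 - P q.1).
have cH : continuous2 av H := continuous2_shear HK cG cP.
have mG := continuous2_measurable HK cG.
have mH := continuous2_measurable HK cH.
have mG1 (u : Borel av) : measurable_fun setT (fun v : Borel av => G (u, v)).
  exact: (measurableT_comp mG (pair1_measurable u)).
have mH2 (w : Borel av) : measurable_fun setT (fun u : Borel av => H (u, w)).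
  exact: (measurableT_comp mH (pair2_measurable w)).
have iG1 u : mu.-integrable setT (fun v : Borel av => (G (u, v))%:E).
  apply: (le_integrable measurableT _ _ (integrableZl measurableT (C * phi u) iphi)).
    exact/measurable_EFinP.
  move=> v _; rewrite -EFinM /= lee_fin; apply: le_trans (Gle u v) _.
  by rewrite ger0_norm ?mulr_ge0 ?phi0 //; exact: phi0.
(* On a horizontal section the second factor is [phi (w - P u)]; bounding it by 1 leaves the
   integrable function [C * phi u]. *)
have iH2 w : mu.-integrable setT (fun u : Borel av => (H (u : K, w))%:E).
  apply: (le_integrable measurableT _ _ (integrableZl measurableT C iphi)).
    by apply/measurable_EFinP; exact: mH2.
  move=> u _; rewrite -EFinM /= lee_fin; apply: le_trans (Gle _ _) _.
  rewrite ger0_norm ?mulr_ge0 //; last exact: phi0.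
  by rewrite ler_piMr ?mulr_ge0 ?phi0 //; exact: phi1.
have GH (u : Borel av) :
    (\int[mu]_v (G (u, v))%:E = \int[m]_w (H (u, w))%:E)%E.
  rewrite -(Haar_translate (P u) Hmu (g := fun v => (G (u, v))%:E)) //.
  exact/measurable_EFinP.
have mabs : measurable_fun setT (fun q : Borel av * Borel av => `|(H q)%:E|%E).
  by apply: measurableT_comp => //; exact/measurable_EFinP.
have iH : (m \x m)%E.-integrable setT (fun q : Borel av * Borel av => (H q)%:E).
  apply/integrable12ltyP; first exact/measurable_EFinP.
  (* Tonelli's criterion: once the shear is translated away, the inner integral is at most [phi u]
     times the constant [C] times the integral of [phi]. *)
  apply: (@le_lt_trans _ _ (\int[mu]_u ((C%:E * \int[mu]_x (phi x)%:E) * (phi u)%:E))%E).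
    apply: ge0_le_integral => //.
    - move=> x _; exact: integral_ge0.
    - exact: (measurable_fun_fubini_tonelli_F (m2 := m) _ mabs (fun q => abse_ge0 _)).
    - by apply: measurable_funeM; exact: (measurable_int mu iphi).
    - move=> u _.
      rewrite -[X in (X <= _)%E]/(\int[mu]_w `|(G (u : K, ((w : K) - P u)%R))%:E|)%E.
      rewrite (ge0_Haar_translate (P u) Hmu (g := fun v => `|(G (u, v))%:E|%E)) //; last first.
        by apply: measurableT_comp => //; exact/measurable_EFinP.
      rewrite muleAC -EFinM -ge0_integralZl_EFin ?mulr_ge0 //; last first.
      + exact: (measurable_int mu iphi).
      + by move=> x _; rewrite lee_fin; exact: phi0.
      + apply: ge0_le_integral => //.
        * by apply: measurableT_comp => //; exact/measurable_EFinP.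
        * by apply: measurable_funeM; exact: (measurable_int mu iphi).
        * by move=> v _; rewrite lee_fin; exact: Gle.
  have fi := integrable_fin_num measurableT iphi.
  rewrite -(fineK fi) -EFinM; apply: integrable_lty => //.
  exact: (integrableZl measurableT _ iphi).
(* The inner integrals are finite, so [fine] loses nothing. *)
have fG u : (fine (\int[mu]_v (G (u, v))%:E)%E)%:E = (\int[m]_w (H (u, w))%:E)%E.
  by rewrite fineK ?GH //; rewrite -GH; exact: integrable_fin_num.
have fH w : (fine (\int[mu]_u (H (u : K, w))%:E)%E)%:E = (\int[m]_u (H (u, w))%:E)%E.
  by rewrite fineK //; exact: integrable_fin_num.
split => //.
- under eq_fun do rewrite fG; exact: (integrable_fubini_F iH).
- under eq_fun do rewrite fH.
  have mHE := measurable_int _ iH.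
  (* The absolute value of the partial integral is at most the partial integral of the absolute
     value, which has finite integral by Tonelli in the other order. *)
  apply/integrableP; split; first exact: (measurable_fubini_G iH).
  apply: le_lt_trans ((integrable21ltyP m m mHE).1 iH).
  apply: ge0_le_integral => //.
  - by apply: measurableT_comp => //; exact: (measurable_fubini_G iH).
  - exact: (measurable_fun_fubini_tonelli_G (m1 := m) _ mabs (fun q => abse_ge0 _)).
  - move=> w _; apply: le_abse_integral => //.
    by apply/measurable_EFinP; exact: mH2.
- under eq_integral do rewrite fH.
  under [RHS]eq_integral do rewrite fG.
  exact/esym/(Fubini iH).
Qed.

(** * Schwartz-Bruhat functions *)

Lemma row_entry_le_norm (R : realType) (m : nat) (x : 'rV[R]_m) (j : 'I_m) :
  `|x 0 j| <= `|x|.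
Proof.
rewrite [leRHS]/Num.norm /= mx_normrE.
exact: (le_bigmax _ (fun ij : 'I_1 * 'I_m => `|x ij.1 ij.2|) (0, j)).
Qed.

Lemma row_norm_lt (R : realType) (m : nat) (x : 'rV[R]_m) (e : R) :
  0 < e -> (forall j, `|x 0 j| < e) -> `|x| < e.
Proof.
move=> e0 h; rewrite [ltLHS]/Num.norm /= mx_normrE; apply: bigmax_lt => //.
by move=> [i j] _; rewrite /= ord1.
Qed.

(* [emb] lists the real coordinates of a point of K * K, for K = R or C. *)
Lemma archimedean_regular (R : realType) (K S : fieldType) (av : K -> R)
    (absS : S -> R) (phi : K -> S) (psi : S -> K) (m : nat)
    (emb : K * K -> 'rV[R]_m) (G : 'rV[R]_m -> R) :
  top_field_iso av absS phi psi -> (forall s, 0 <= absS s) ->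
  (forall p, absS (phi p.1) <= 2 * `|emb p|) ->
  (forall p, absS (phi p.2) <= 2 * `|emb p|) ->
  (forall p q d, 0 < d -> absS (phi q.1 - phi p.1) < d ->
     absS (phi q.2 - phi p.2) < d -> `|emb q - emb p| < d) ->
  real_schwartz G ->
  continuous2 av (G \o emb) /\ rapid_decay av (G \o emb).
Proof.
move=> [[_ _ phiD _ _] [c [c0 avE]]] abs0 b1 b2 he [cG dG].
have phiB x y : phi (x - y) = phi x - phi y.
  by apply/eqP; rewrite eq_sym subr_eq -phiD subrK.
have small x e : 0 < e -> av x < e `^ c -> absS (phi x) < e.
  move=> e0; rewrite avE !ltNge; apply: contra => h.
  by apply: ge0_ler_powR; rewrite ?nnegrE ?(ltW c0) ?(ltW e0) ?abs0.
split.
  (* The empty list of derivatives gives continuity, and below decay, of [G] itself. *)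
  move=> p e e0; have [+ _] := cG [::].
  move=> /(_ (emb p)) /cvgrPdist_lt /(_ e e0) /nbhs_normP[d /= d0 hd].
  exists (d `^ c); split; first exact: powR_gt0.
  move=> q /(small _ _ d0) h1 /(small _ _ d0) h2.
  rewrite distrC; apply: hd => /=; rewrite distrC.
  by apply: he; rewrite -?phiB.
(* An integer above the exponent [c] in [av x = absS (phi x) ^ c], so that [av] is bounded by an
   integral power of [2 (1 + t)]. *)
move=> N; pose k := (Num.truncn c).+1.
have avle x t : 0 <= t -> absS (phi x) <= 2 * t ->
    1 + av x <= 2 ^+ k.+1 * (1 + t) ^+ k.
  move=> t0 xt; have h1 : 1 <= 2 * (1 + t) by rewrite mulrDr mulr1 ler_wpDr ?ler1n ?mulr_ge0.
  have h2 : av x <= (2 * (1 + t)) ^+ k.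
    rewrite avE -powR_mulrn; last exact: le_trans h1.
    apply: (@le_trans _ _ ((2 * (1 + t)) `^ c)).
      apply: ge0_ler_powR; rewrite ?nnegrE ?abs0 ?(ltW c0) //.
        exact: le_trans h1.
      by apply: (le_trans xt); rewrite ler_pM2l // lerDr.
    by apply: ler_powR => //; rewrite ltW // truncnS_gt // num_real.
  rewrite exprS -mulrA -exprMn mulr_natl mulr2n lerD //.
  exact: exprn_ege1.
(* Each of the two weights costs [k * N] powers of [1 + |v|]. *)
have [C hC] := dG [::] (k * N + k * N)%N.
exists ((2 ^+ k.+1) ^+ N * (2 ^+ k.+1) ^+ N * C) => p /=.
set v := emb p; have v0 : 0 <= `|v| by [].
have av0' x : 0 <= 1 + av x by rewrite avE addr_ge0 // powR_ge0.
have hN x : absS (phi x) <= 2 * `|v| ->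
    (1 + av x) ^+ N <= (2 ^+ k.+1) ^+ N * (1 + `|v|) ^+ (k * N).
  move=> hx; rewrite exprM -exprMn; apply: lerXn2r; rewrite ?nnegrE //.
  exact: avle.
apply: le_trans (_ : (2 ^+ k.+1) ^+ N * (2 ^+ k.+1) ^+ N *
    ((1 + `|v|) ^+ (k * N + k * N) * `|G v|) <= _); last first.
  by apply: ler_wpM2l; [rewrite mulr_ge0 // !exprn_ge0|exact: hC].
rewrite exprD mulrC; apply: le_trans (_ : (_ * (1 + `|v|) ^+ (k * N)) *
    (_ * (1 + `|v|) ^+ (k * N)) * `|G v| <= _).
  by apply: ler_wpM2r => //; apply: ler_pM; rewrite ?exprn_ge0 //; apply: hN.
rewrite le_eqVlt; apply/orP; left; apply/eqP; ring.
Qed.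

(** Division by [z ^ k] with [r <= av z ^ k] moves the sequence into the unit ball, where local
    compactness applies. *)
Lemma closed_ball_compact (R : realType) (K : fieldType) (av : K -> R) (r : R)
    (s : nat -> K) : is_local_field av -> (forall n, av (s n) <= r) ->
  exists (phi : nat -> nat) (l : K), {homo phi : i j / (i < j)%N} /\
    forall e : R, 0 < e -> exists M : nat, forall n, (M <= n)%N ->
      av (s (phi n) - l) < e.
Proof.
move=> HK hs; have [z z1] := av_gt1 HK.
have z0 : z != 0 by apply/eqP => z0; move: z1; rewrite z0 (av0 HK) ltr10.
have [k hk] := expr_unbounded r z1.
have w0 : z ^+ k != 0 by rewrite expf_neq0.
have w_gt0 := av_neq0 HK w0.
have [|phi [l [phiS [_ hl]]]] := av_loc_compact HK (s := fun n => s n / z ^+ k).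
  move=> n; rewrite (av_mul HK) (avV HK) // ler_pdivrMr // mul1r (avX _ _ HK).
  exact: le_trans hk.
exists phi, (l * z ^+ k); split; first by apply: homo_ltn => //; exact: ltn_trans.
move=> e e0; have [M hM] := hl _ (divr_gt0 e0 w_gt0).
exists M => n /hM; rewrite ltr_pdivlMr // -(av_mul HK) mulrBl divfK //.
Qed.

(** Local constancy gives continuity. It also gives boundedness: points of the support with
    unbounded values would accumulate at a point near which [f] is constant. A bounded function of
    bounded support satisfies every decay estimate. The map [g] stands for the real or imaginary
    part. *)
Lemma locally_constant_regular (R : realType) (K : fieldType) (av : K -> R)
    (T : eqType) (t0 : T) (f : K * K -> T) (g : T -> R) (r : R) :
  is_local_field av -> g t0 = 0 ->
  (forall p : K * K, exists e : R, 0 < e /\ forall q : K * K,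
     av (q.1 - p.1) < e -> av (q.2 - p.2) < e -> f q = f p) ->
  (forall p : K * K, f p != t0 -> av p.1 <= r /\ av p.2 <= r) ->
  continuous2 av (g \o f) /\ rapid_decay av (g \o f).
Proof.
move=> HK gt0 lc supp; split.
  move=> p e e0; have [d [d0 hd]] := lc p; exists d; split => // q h1 h2.
  by rewrite /= (hd q) // subrr normr0.
have [C hC] : exists C, forall p, `|g (f p)| <= C.
  apply: contrapT => /forallNP hno.
  have /choice[s hs] : forall n : nat, exists p, n%:R < `|g (f p)|.
    by move=> n; have /existsNP[p /negP] := hno n%:R; rewrite -ltNge; exists p.
  have sup n : av (s n).1 <= r /\ av (s n).2 <= r.
    apply: supp; apply/eqP => fs; have := hs n.
    by rewrite fs gt0 normr0 ltNge ler0n.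
  have [phi [l [phiS hl]]] := closed_ball_compact HK (fun n => (sup n).1).
  (* A second extraction, along the first, makes the other coordinate converge as well. *)
  have [phi' [l' [phiS' hl']]] := closed_ball_compact HK (fun n => (sup (phi n)).2).
  have [e [e0 he]] := lc (l, l').
  have [M hM] := hl _ e0; have [M' hM'] := hl' _ e0.
  have ge_id (h : nat -> nat) : {homo h : i j / (i < j)%N} -> forall n, (n <= h n)%N.
    by move=> hh; elim=> // n IH; apply: leq_ltn_trans IH (hh _ _ _).
  (* Far enough for both coordinates to be near the limit, and beyond the value at the limit, which
     contradicts the growth of the values. *)
  pose n := maxn (maxn M M') (Num.truncn `|g (f (l, l'))|).+1.
  have Mn : (M <= phi' n)%N.
    by apply: leq_trans (ge_id _ phiS' n); rewrite /n -maxnA leq_maxl.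
  have Mn' : (M' <= n)%N by rewrite /n maxnAC leq_maxr.
  have := hs (phi (phi' n)); rewrite (he (s (phi (phi' n)))) /=; first last.
  - exact: hM'.
  - exact: hM.
  rewrite ltNge => /negP; apply.
  apply: (@le_trans _ _ (Num.truncn `|g (f (l, l'))|).+1%:R).
    by rewrite ltW // truncnS_gt // num_real.
  rewrite ler_nat; apply: leq_trans (leq_trans (ge_id _ phiS' n) (ge_id _ phiS _)).
  exact: leq_maxr.
move=> N; exists (C * ((1 + `|r|) ^+ N * (1 + `|r|) ^+ N)) => p /=.
have C0 : 0 <= C by apply: le_trans (hC (0, 0)).
have r0 : 0 <= 1 + `|r| by rewrite addr_ge0.
have [fp|/supp[h1 h2]] := eqVneq (f p) t0.
  by rewrite fp gt0 normr0 mul0r !mulr_ge0 // exprn_ge0.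
have hx x : av x <= r -> 0 <= (1 + av x) ^+ N <= (1 + `|r|) ^+ N.
  move=> xr; have x0 : 0 <= 1 + av x by rewrite addr_ge0 // (av_ge0 HK).
  rewrite exprn_ge0 //= lerXn2r ?nnegrE // lerD2l.
  exact: le_trans (ler_norm r).
have /andP[a1 a2] := hx _ h1; have /andP[b1 b2] := hx _ h2.
by apply: ler_pM => //; [exact: mulr_ge0|apply: ler_pM].
Qed.

Lemma normc_Re_le (R : realType) (z : R[i]) : `|complex.Re z| <= Normc.normc z.
Proof.
case: z => a b /=; rewrite -sqrtr_sqr ler_wsqrtr // lerDl sqr_ge0 //.
Qed.

Lemma normc_Im_le (R : realType) (z : R[i]) : `|complex.Im z| <= Normc.normc z.
Proof.
case: z => a b /=; rewrite -sqrtr_sqr ler_wsqrtr // lerDr sqr_ge0 //.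
Qed.

Lemma normc_le (R : realType) (z : R[i]) :
  Normc.normc z <= `|complex.Re z| + `|complex.Im z|.
Proof.
case: z => a b /=; rewrite -[leRHS]ger0_norm ?addr_ge0 // -sqrtr_sqr.
rewrite ler_wsqrtr // sqrrD !real_normK ?num_real //.
by rewrite lerD2r lerDl mulrn_wge0 // mulr_ge0.
Qed.

(** Reduces the three kinds of local field to the two properties used in the integration argument,
    continuity and rapid decay. *)
Lemma Schwartz_Bruhat_regular (R : realType) (K : fieldType) (av : K -> R)
    (f : K * K -> R[i]) : is_local_field av -> Schwartz_Bruhat av f ->
  (continuous2 av (fun p => complex.Re (f p)) /\
   rapid_decay av (fun p => complex.Re (f p))) /\
  (continuous2 av (fun p => complex.Im (f p)) /\
   rapid_decay av (fun p => complex.Im (f p))).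
Proof.
move=> HK [[_ [lc [r supp]]]|[[phi [psi [iso [sRe sIm]]]]|[phi [psi [iso [sRe sIm]]]]]].
- split.
    exact: (locally_constant_regular (g := @complex.Re R) HK _ lc supp).
  exact: (locally_constant_regular (g := @complex.Im R) HK _ lc supp).
- pose emb (p : K * K) : 'rV[R]_2 := \row_i (if i == 0 then phi p.1 else phi p.2).
  have fE p : f (psi (emb p 0 0), psi (emb p 0 1)) = f p.
    have [[phiK _ _ _ _] _] := iso.
    by rewrite !mxE /= !phiK -surjective_pairing.
  have b1 p : `|phi p.1| <= 2 * `|emb p|.
    have := row_entry_le_norm (emb p) 0; rewrite mxE /= => /le_trans; apply.
    by rewrite ler_peMl // ler1n.
  have b2 p : `|phi p.2| <= 2 * `|emb p|.
    have := row_entry_le_norm (emb p) 1; rewrite mxE /= => /le_trans; apply.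
    by rewrite ler_peMl // ler1n.
  have he p q d : 0 < d -> `|phi q.1 - phi p.1| < d -> `|phi q.2 - phi p.2| < d ->
      `|emb q - emb p| < d.
    move=> d0 h1 h2; apply: row_norm_lt => // j; rewrite !mxE.
    by case: ifP.
  by split; [have := archimedean_regular iso (@normr_ge0 _ _) b1 b2 he sRe
            |have := archimedean_regular iso (@normr_ge0 _ _) b1 b2 he sIm];
     rewrite /comp; under eq_fun do rewrite fE.
- pose emb (p : K * K) : 'rV[R]_4 := \row_i nth 0
    [:: complex.Re (phi p.1); complex.Im (phi p.1);
        complex.Re (phi p.2); complex.Im (phi p.2)] i.
  have fE p : f (psi (Complex (emb p 0 0) (emb p 0 1)),
                 psi (Complex (emb p 0 2) (emb p 0 3))) = f p.
    have [[phiK _ _ _ _] _] := iso.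
    have ReIm (z : R[i]) : Complex (complex.Re z) (complex.Im z) = z by case: z.
    by rewrite !mxE /= !ReIm !phiK -surjective_pairing.
  have n0 (z : R[i]) : 0 <= Normc.normc z.
    exact: le_trans (normc_Re_le z).
  (* The factor 2 arises here: the modulus is at most the sum of two coordinates, each bounded by
     the maximum norm. *)
  have b1 p : Normc.normc (phi p.1) <= 2 * `|emb p|.
    apply: le_trans (normc_le _) _; rewrite mulr_natl mulr2n lerD //.
      by have := row_entry_le_norm (emb p) 0; rewrite mxE.
    by have := row_entry_le_norm (emb p) 1; rewrite mxE.
  have b2 p : Normc.normc (phi p.2) <= 2 * `|emb p|.
    apply: le_trans (normc_le _) _; rewrite mulr_natl mulr2n lerD //.
      by have := row_entry_le_norm (emb p) 2; rewrite mxE.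
    by have := row_entry_le_norm (emb p) 3; rewrite mxE.
  have he p q d : 0 < d -> Normc.normc (phi q.1 - phi p.1) < d ->
      Normc.normc (phi q.2 - phi p.2) < d -> `|emb q - emb p| < d.
    move=> d0 h1 h2; apply: row_norm_lt => // j; rewrite !mxE.
    have ReB (z w : R[i]) : complex.Re z - complex.Re w = complex.Re (z - w).
      by case: z w => ? ? [].
    have ImB (z w : R[i]) : complex.Im z - complex.Im w = complex.Im (z - w).
      by case: z w => ? ? [].
    case: j => [[|[|[|[|//]]]] /= _]; rewrite ?ReB ?ImB.
    + exact: le_lt_trans (normc_Re_le _) h1.
    + exact: le_lt_trans (normc_Im_le _) h1.
    + exact: le_lt_trans (normc_Re_le _) h2.
    + exact: le_lt_trans (normc_Im_le _) h2.
  by split; [have := archimedean_regular iso n0 b1 b2 he sRe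
            |have := archimedean_regular iso n0 b1 b2 he sIm];
     rewrite /comp; under eq_fun do rewrite fE.
Qed.

Lemma av_continuous_horner (R : realType) (K : fieldType) (av : K -> R)
    (P : {poly K}) : is_local_field av -> av_continuous av (fun x => P.[x]).
Proof.
move=> HK; elim/poly_ind: P => [|P c IH] x e e0.
  by exists 1; split => // y _; rewrite !horner0 subrr (av0 HK).
(* [M] bounds both [av P.[x]] and [av y] for [y] within distance 1 of [x], hence both cofactors in
   the splitting of the increment below. *)
pose M := 1 + av x + av P.[x].
have M0 : 0 < M by rewrite /M -addrA ltr_pwDl // addr_ge0 ?(av_ge0 HK).
have e1 : 0 < e / 2 / M by rewrite !divr_gt0.
have [d [d0 hd]] := IH x _ e1.
exists (Num.min (Num.min d 1) (e / 2 / M)); split.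
  by rewrite !lt_min d0 ltr01.
move=> y; rewrite !lt_min => /andP[/andP[/hd h1 h2] h3].
rewrite !hornerMXaddC.
have -> : P.[y] * y + c - (P.[x] * x + c) = (P.[y] - P.[x]) * y + P.[x] * (y - x).
  by ring.
have yM : av y <= M.
  have -> : y = (y - x) + x by ring.
  apply: le_trans (av_tri HK _ _) _; apply: ler_wpDr; first exact: (av_ge0 HK).
  by rewrite lerD2r ltW.
apply: le_lt_trans (av_tri HK _ _) _; rewrite !(av_mul HK).
rewrite [ltRHS]splitr; apply: ltr_leD.
  apply: (@le_lt_trans _ _ (av (P.[y] - P.[x]) * M)).
    by apply: ler_wpM2l => //; exact: (av_ge0 HK).
  by rewrite -ltr_pdivlMr.
apply: (@le_trans _ _ (M * av (y - x))).
  apply: ler_wpM2r; first exact: (av_ge0 HK).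
  by rewrite /M lerDr addr_ge0 // (av_ge0 HK).
by rewrite mulrC -ler_pdivlMr // ltW.
Qed.

(** * The valuation ring and lifted functions *)

Lemma nu1 (F K : fieldType) (nu : F -> int) (t : F) (res : F -> K) :
  is_cdvf nu t res -> nu 1 = 0.
Proof.
move=> HF; have := cdvf_mul HF (oner_neq0 F) (oner_neq0 F).
by rewrite mulr1 -[LHS]addr0 => /addrI.
Qed.

Lemma nuN (F K : fieldType) (nu : F -> int) (t : F) (res : F -> K) (x : F) :
  is_cdvf nu t res -> nu (- x) = nu x.
Proof.
move=> HF; have [->|x0] := eqVneq x 0; first by rewrite oppr0.
have m1 : (-1 : F) != 0 by rewrite oppr_eq0 oner_eq0.
(* From [(-1) * (-1) = 1] follows [2 nu(-1) = 0]. *)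
have := cdvf_mul HF m1 m1; rewrite mulrNN mulr1 (nu1 HF) => h.
have -> : nu (- x) = nu (-1) + nu x by rewrite -[- x]mulN1r (cdvf_mul HF m1 x0).
by move: h; set k := nu (-1); set l := nu x; lia.
Qed.

Lemma nuX (F K : fieldType) (nu : F -> int) (t : F) (res : F -> K) (n : int) :
  is_cdvf nu t res -> nu (t ^ n) = n.
Proof.
move=> HF; have t0 := cdvf_t_neq0 HF.
have pos (k : nat) : nu (t ^+ k) = k%:Z.
  elim: k => [|k IH]; first by rewrite expr0 (nu1 HF).
  by rewrite exprS (cdvf_mul HF) ?expf_neq0 // IH (cdvf_t HF); lia.
case: n => k; first exact: pos.
have tk : t ^+ k.+1 != 0 by rewrite expf_neq0.
have := cdvf_mul HF tk (invr_neq0 tk).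
rewrite divff // (nu1 HF) pos => /eqP; rewrite eq_sym addrC addr_eq0 => /eqP h.
by rewrite /exprz h NegzE.
Qed.

Lemma inO0 (F : fieldType) (nu : F -> int) : inO nu 0.
Proof. by left. Qed.

Lemma inON (F K : fieldType) (nu : F -> int) (t : F) (res : F -> K) (x : F) :
  is_cdvf nu t res -> inO nu x -> inO nu (- x).
Proof.
by move=> HF [->|x0]; [left; rewrite oppr0|right; rewrite (nuN _ HF)].
Qed.

Lemma inOD (F K : fieldType) (nu : F -> int) (t : F) (res : F -> K) (x y : F) :
  is_cdvf nu t res -> inO nu x -> inO nu y -> inO nu (x + y).
Proof.
move=> HF Ox Oy; have [->|xy0] := eqVneq (x + y) 0; first by left.
have [x0|x0] := eqVneq x 0; first by rewrite x0 add0r.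
have [y0|y0] := eqVneq y 0; first by rewrite y0 addr0.
case: Ox Oy => [/eqP|nx]; first by rewrite (negbTE x0).
case=> [/eqP|ny]; first by rewrite (negbTE y0).
by right; apply: le_trans (cdvf_add HF x0 y0 xy0); rewrite le_min nx.
Qed.

Lemma inOM (F K : fieldType) (nu : F -> int) (t : F) (res : F -> K) (x y : F) :
  is_cdvf nu t res -> inO nu x -> inO nu y -> inO nu (x * y).
Proof.
move=> HF; have [->|x0] := eqVneq x 0; first by left; rewrite mul0r.
have [->|y0] := eqVneq y 0; first by left; rewrite mulr0.
case=> [/eqP|nx]; first by rewrite (negbTE x0).
case=> [/eqP|ny]; first by rewrite (negbTE y0).
by right; rewrite (cdvf_mul HF) // addr_ge0.
Qed.

Lemma inOX (F K : fieldType) (nu : F -> int) (t : F) (res : F -> K) (x : F) (n : nat) :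
  is_cdvf nu t res -> inO nu x -> inO nu (x ^+ n).
Proof.
move=> HF Ox; elim: n => [|n IH]; first by right; rewrite expr0 (nu1 HF).
by rewrite exprS; apply: (inOM HF _ _).
Qed.

Lemma res0 (F K : fieldType) (nu : F -> int) (t : F) (res : F -> K) :
  is_cdvf nu t res -> res 0 = 0.
Proof. by move=> HF; apply/(res_ker HF (inO0 nu)); left. Qed.

Lemma resB (F K : fieldType) (nu : F -> int) (t : F) (res : F -> K) (x y : F) :
  is_cdvf nu t res -> inO nu x -> inO nu y -> res (x - y) = res x - res y.
Proof.
move=> HF Ox Oy; apply/eqP; rewrite eq_sym subr_eq -(res_add HF) //.
  by rewrite subrK.
by apply: (inOD HF _ _) => //; apply: (inON HF _).
Qed.

Lemma resX (F K : fieldType) (nu : F -> int) (t : F) (res : F -> K) (x : F) (n : nat) :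
  is_cdvf nu t res -> inO nu x -> res (x ^+ n) = res x ^+ n.
Proof.
move=> HF Ox; elim: n => [|n IH]; first by rewrite !expr0 (res_one HF).
by rewrite !exprS (res_mul HF) ?IH //; apply: (inOX _ HF _).
Qed.

(** On the valuation ring [res] is a ring morphism, so it commutes with evaluation of integral
    polynomials. *)
Lemma res_horner (F K : fieldType) (nu : F -> int) (t : F) (res : F -> K)
    (q : {poly F}) (x : F) : is_cdvf nu t res ->
  (forall i, inO nu q`_i) -> inO nu x ->
  inO nu q.[x] /\ res q.[x] = (\poly_(i < size q) res q`_i).[res x].
Proof.
move=> HF Oq Ox; rewrite horner_poly horner_coef.
pose good u v := inO nu u /\ res u = v.
apply: (big_ind2 good) => [|u1 v1 u2 v2 [i1 <-] [i2 <-]|i _].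
- by split; [exact: inO0|exact: (res0 HF)].
- by split; [exact: (inOD HF _ _)|exact: (res_add HF)].
- have Oxi := inOX (i : nat) HF Ox; split; first exact: (inOM HF _ _).
  by rewrite (res_mul HF) // (resX _ HF).
Qed.

(* [P] is the reduction of t^(R' - n2) q; it vanishes when the depth is positive. *)
Lemma shear_valuation (F K : fieldType) (nu : F -> int) (t : F) (res : F -> K)
    (a1 : F) (n1 n2 : int) (h : {poly F}) :
  is_cdvf nu t res -> depth_nonneg nu t res a1 n1 n2 h ->
  exists P : {poly K}, forall x a y : F, inO nu ((x - a1) / t ^ n1) ->
    let w := (y - (h.[a1] + a)) / t ^ n2 in
    let v := (y - h.[x] - a) / t ^ n2 in
    (inO nu v <-> inO nu w) /\
    (inO nu w -> res v = res w - P.[res ((x - a1) / t ^ n1)]).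
Proof.
move=> HF [_ [r [q [hq [Oq [_ rn]]]]]].
have t0 := cdvf_t_neq0 HF.
(* Non-negative depth is used here: it makes the coefficients of [Q] integral. *)
pose Q := t ^ (r - n2) *: q.
have OQ i : inO nu Q`_i.
  by rewrite coefZ; apply: (inOM HF _ (Oq i)); right; rewrite (nuX _ HF).
exists (\poly_(i < size Q) res Q`_i) => x a y Ox w v.
set x' := (x - a1) / t ^ n1 in Ox *.
have [OQx rQx] := res_horner HF OQ Ox.
(* Since [h(x) = h(a1) + t^r q(x')], dividing by [t^n2] turns the shift by [h(x) - h(a1)] into
   [Q(x')], which is integral. *)
have vE : v = w - Q.[x'].
  have hx : h.[x] = h.[a1] + t ^ r * q.[x'].
    have xE : a1 + t ^ n1 * x' = x by rewrite mulrC divfK ?expfz_neq0 // addrC subrK.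
    have := congr1 (horner^~ x') hq.
    by rewrite horner_comp !hornerD !hornerC !hornerZ hornerX xE.
  rewrite /v /w hx /Q hornerZ expfzDr // -[t ^ (- n2)]invr_expz.
  by ring.
have vO : inO nu v <-> inO nu w.
  rewrite vE; split=> O; first rewrite -(subrK Q.[x'] w); apply: (inOD HF _ _) => //.
  exact: (inON HF _).
by split=> // Ow; rewrite vE (resB HF) // rQx.
Qed.

(** * Fubini on the residue field and its lift to [F] *)

Lemma Schwartz_Bruhat_shear (R : realType) (K : fieldType) (av : K -> R)
    (mu : {measure set (Borel av) -> \bar R}) (f : K * K -> R[i]) (P : {poly K}) :
  is_local_field av -> is_Haar mu -> Schwartz_Bruhat av f ->
  [/\ forall u, Haar_integrable mu (fun v => f (u, v)),
      Haar_integrable mu (fun u => HaarInt mu (fun v => f (u, v))),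
      forall w, Haar_integrable mu (fun u => f (u, w - P.[u])),
      Haar_integrable mu (fun w => HaarInt mu (fun u => f (u, w - P.[u]))) &
      HaarInt mu (fun w => HaarInt mu (fun u => f (u, w - P.[u]))) =
      HaarInt mu (fun u => HaarInt mu (fun v => f (u, v)))].
Proof.
move=> HK Hmu Hf; have [[cRe dRe] [cIm dIm]] := Schwartz_Bruhat_regular HK Hf.
have cP := av_continuous_horner P HK.
have [re1 re2 re3 re4 re5] := shear_Fubini HK Hmu cRe dRe cP.
have [im1 im2 im3 im4 im5] := shear_Fubini HK Hmu cIm dIm cP.
split; [by split|by split|by split|by split|].
by rewrite /HaarInt /= re5 im5.
Qed.

Lemma F_integral0 (R : realType) (F K : fieldType) (nu : F -> int) (t : F)
    (res : F -> K) (av : K -> R) (mu : {measure set (Borel av) -> \bar R})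
    (g : F -> CX R) :
  (forall y, g y = 0) -> F_integral nu t res mu g 0.
Proof.
by move=> g0; exists [::]; split=> //; split=> [y|]; rewrite big_nil.
Qed.

(** A combination with a single term. The scalar [c] absorbs the power of [Xf] left by the other
    variable. *)
Lemma F_integral_lift (R : realType) (F K : fieldType) (nu : F -> int) (t : F)
    (res : F -> K) (av : K -> R) (mu : {measure set (Borel av) -> \bar R})
    (g : F -> CX R) (c : CX R) (phi : K -> R[i]) (a : F) (n : int) :
  Haar_integrable mu phi -> (forall y, g y = c * liftF nu t res phi a n y) ->
  F_integral nu t res mu g (c * fcst (HaarInt mu phi) * Xf ^ n).
Proof.
move=> iphi gE; exists [:: (c, (phi, (a, n)))]; split.
  by move=> e; rewrite inE => /eqP ->.
by split=> [y|]; rewrite big_seq1.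
Qed.

Lemma lift0_in (R : realType) (F K : fieldType) (nu : F -> int) (res : F -> K)
    (phi : K -> R[i]) (x : F) :
  inO nu x -> Defs.lift0 nu res phi x = fcst (phi (res x)).
Proof. by rewrite /Defs.lift0; case: asboolP. Qed.

Lemma lift0_out (R : realType) (F K : fieldType) (nu : F -> int) (res : F -> K)
    (phi : K -> R[i]) (x : F) : ~ inO nu x -> Defs.lift0 nu res phi x = 0.
Proof. by rewrite /Defs.lift0; case: asboolP. Qed.

Lemma lift2F_liftF (R : realType) (F K : fieldType) (nu : F -> int) (t : F)
    (res : F -> K) (f : K * K -> R[i]) (a1 a2 : F) (n1 n2 : int) (x y : F) :
  inO nu ((x - a1) / t ^ n1) ->
  lift2F nu t res f a1 a2 n1 n2 x y =
  liftF nu t res (fun v => f (res ((x - a1) / t ^ n1), v)) a2 n2 y.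
Proof.
move=> Ox; rewrite /lift2F /liftF /Defs.lift0.
suff -> : `[< inO nu ((x - a1) / t ^ n1) /\ inO nu ((y - a2) / t ^ n2) >] =
  `[< inO nu ((y - a2) / t ^ n2) >] by exact: erefl.
by apply/asboolP/asboolP => [[]|].
Qed.

Lemma lift2F_out (R : realType) (F K : fieldType) (nu : F -> int) (t : F)
    (res : F -> K) (f : K * K -> R[i]) (a1 a2 : F) (n1 n2 : int) (x y : F) :
  ~ (inO nu ((x - a1) / t ^ n1) /\ inO nu ((y - a2) / t ^ n2)) ->
  lift2F nu t res f a1 a2 n1 n2 x y = 0.
Proof. by rewrite /lift2F; case: asboolP. Qed.

Lemma mul_exprzD (L : fieldType) (c x : L) (n1 n2 : int) :
  x != 0 -> c * x ^ (n1 + n2) = x ^ n1 * c * x ^ n2.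
Proof. by move=> x0; rewrite expfzDr // mulrA [c * _]mulrC. Qed.

Unset Implicit Arguments.
Set Strict Implicit.

Theorem theorem5p5 (R : realType) (F K : fieldType)
    (nu : F -> int) (t : F) (res : F -> K) (HF : is_cdvf nu t res)
    (av : K -> R) (HK : is_local_field av)
    (mu : {measure set (Borel av) -> \bar R}) (Hmu : is_Haar mu)
    (a1 a2 : F) (n1 n2 : int) (h : {poly F})
    (Hdepth : depth_nonneg nu t res a1 n1 n2 h)
    (f : K * K -> R[i]) (Hf : Schwartz_Bruhat av f) :
  is_Fubini nu t res mu
    (fun x y => lift2F nu t res f a1 a2 n1 n2 x (y - h.[x]))
    (fcst (HaarInt mu (fun v : K => HaarInt mu (fun u : K => f (u, v))))
       * Xf ^ (n1 + n2)).
Proof.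
have [P hP] := shear_valuation HF Hdepth.
have [i1 i2 i3 i4 shearE] := Schwartz_Bruhat_shear P HK Hmu Hf.
have X0 : (Xf : CX R) != 0 by rewrite tofrac_eq0 polyX_eq0.
(* The shear by the zero polynomial is ordinary Fubini on [K], which exchanges the order of
   integration. *)
have swapE : HaarInt mu (fun v => HaarInt mu (fun u => f (u, v))) =
    HaarInt mu (fun u => HaarInt mu (fun v => f (u, v))).
  have [_ _ _ _ <-] := Schwartz_Bruhat_shear 0 HK Hmu Hf.
  by congr HaarInt; apply/funext => v; congr HaarInt; apply/funext => u;
     rewrite horner0 subr0.
(* Up to powers of [Xf], [A] and [B] are the partial integrals over [y] and over [x]. [B] is centred
   at [h(a1) + a2], where the sheared coordinate [w] has its origin. *)
pose A := liftF nu t res (fun u => HaarInt mu (fun v => f (u, v))) a1 n1.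
pose B := liftF nu t res (fun w => HaarInt mu (fun u => f (u, w - P.[u])))
  (h.[a1] + a2) n2.
exists (fun x => A x * Xf ^ n2), (fun y => B y * Xf ^ n1).
split; [|split; [|split]].
(* For [x] in [a1 + t^n1 O] the section is the lift of [f (u, _)], with [u] the residue of
   [(x - a1) / t^n1], at centre [h(x) + a2]; for other [x] it vanishes. *)
- move=> x; have [Ox|nOx] := pselect (inO nu ((x - a1) / t ^ n1)).
    rewrite /A /liftF (lift0_in _ _ Ox) -[fcst _]mul1r.
    apply: (F_integral_lift (a := h.[x] + a2)) => [|y]; first exact: i1.
    rewrite mul1r (lift2F_liftF _ _ _ _ _ Ox) /liftF opprD addrA; exact: erefl.
  rewrite /A /liftF (lift0_out _ _ nOx) mul0r; apply: F_integral0 => y.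
  apply: lift2F_out => -[Ox _]; exact: nOx.
(* For [y] in [h(a1) + a2 + t^n2 O] the section is the lift at [a1] of the sheared function of [u].
   For other [y] it vanishes: a non-zero value would require both arguments of [f] integral, and
   then [w] is integral too. *)
- move=> y; have [Oy|nOy] := pselect (inO nu ((y - (h.[a1] + a2)) / t ^ n2)).
    rewrite /B /liftF (lift0_in _ _ Oy) -[fcst _]mul1r.
    apply: (F_integral_lift (a := a1)) => [|x]; first exact: i3.
    rewrite mul1r; have [Ox|nOx] := pselect (inO nu ((x - a1) / t ^ n1)).
      have [vO vE] := hP x a2 y Ox.
      rewrite (lift2F_liftF _ _ _ _ _ Ox) /liftF (lift0_in _ _ Ox).
      rewrite (lift0_in _ _ (vO.2 Oy)) (vE Oy); exact: erefl.
    rewrite /liftF (lift0_out _ _ nOx).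
    apply: lift2F_out => -[Ox _]; exact: nOx.
  rewrite /B /liftF (lift0_out _ _ nOy) mul0r; apply: F_integral0 => x.
  apply: lift2F_out => -[Ox Ov]; apply: nOy; exact: (hP x a2 y Ox).1.1.
(* Lifting the outer integral contributes one of the powers [Xf ^ n1] and [Xf ^ n2]; the other is
   the scalar left by the inner one. *)
- rewrite swapE addrC (mul_exprzD _ _ _ X0).
  by apply: F_integral_lift => [|x]; [exact: i2|exact: mulrC].
- rewrite swapE -shearE (mul_exprzD _ _ _ X0).
  by apply: F_integral_lift => [|y]; [exact: i4|exact: mulrC].
Qed.
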